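(* Let $(X,T)$ and $(Y,T)$ be two weakly isomorphic linearly recurrent subshifts. Then $(X,T)$ and $(Y,T)$ are isomorphic.
   Context: A subshift on a finite alphabet $A$ is a pair $(X,T)$ with $X\subset A^{\mathbb Z}$ closed and $T(X)=X$, $T$ being the shift; it is minimal if it has no proper non-empty closed $T$-invariant subset. $(Y,S')$ is a factor of $(X,S)$ if there is a continuous onto map $\phi:X\to Y$ with $\phi S=S'\phi$ (a factor map); if $\phi$ is also one-to-one it is an isomorphism and the systems are isomorphic. Two dynamical systems are weakly isomorphic if each is a factor of the other. Linearly recurrent: let $x\in A^{\mathbb Z}$ and let $L(x)$ be the set of finite words occurring in $x$. For a non-empty $u\in L(x)$, a return word to $u$ of $x$ is a word $w$ such that $wu\in L(x)$, $u$ is a prefix of $wu$, and $u$ has exactly two occurrences in $wu$. The sequence $x$ is uniformly recurrent if for each word of $L(x)$ the differences between successive occurrences in $x$ are bounded. $x$ is linearly recurrent (LR) with constant $K\in\mathbb N$ if it is uniformly recurrent and $|w|\le K|u|$ for every non-empty $u\in L(x)$ and every return word $w$ to $u$ of $x$. A subshift is linearly recurrent if it is minimal and contains an LR sequence (with some constant $K$). *)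

(* Defs.v *)
From HB Require Import structures.
From mathcomp Require Import all_boot all_order all_algebra.
From mathcomp Require Import all_classical topology.

Set Implicit Arguments.
Unset Strict Implicit.
Unset Printing Implicit Defensive.

Import Order.TTheory GRing.Theory Num.Theory.
Local Open Scope ring_scope.
Local Open Scope classical_set_scope.

(* For X : set E and Y : set F, a map from X to Y is represented by a total
   function from E to F, of which only the values on X are constrained. *)
Definition factor_map (E F : topologicalType) (X : set E) (S : E -> E)
    (Y : set F) (S' : F -> F) (phi : E -> F) : Prop :=
  [/\ {within X, continuous phi},
      phi @` X = Y &
      forall x, X x -> phi (S x) = S' (phi x)].

Definition is_factor (E F : topologicalType) (Y : set F) (S' : F -> F)
    (X : set E) (S : E -> E) : Prop :=
  exists phi : E -> F, factor_map X S Y S' phi.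

Definition isomorphic (E F : topologicalType) (X : set E) (S : E -> E)
    (Y : set F) (S' : F -> F) : Prop :=
  exists phi : E -> F, factor_map X S Y S' phi /\ set_inj X phi.

Definition weakly_isomorphic (E F : topologicalType) (X : set E) (S : E -> E)
    (Y : set F) (S' : F -> F) : Prop :=
  is_factor Y S' X S /\ is_factor X S Y S'.

Definition full_shift (A : finType) : Type :=
  prod_topology (fun _ : int => discrete_topology A).

HB.instance Definition _ (A : finType) := Topological.on (full_shift A).

Definition shift (A : finType) (x : full_shift A) : full_shift A :=
  fun n : int => x (n + 1).

Definition subshift (A : finType) (X : set (full_shift A)) : Prop :=
  closed X /\ @shift A @` X = X.

(* A set Z is T-invariant when T(Z) = Z, as in the definition of subshift. *)
Definition minimal_subshift (A : finType) (X : set (full_shift A)) : Prop :=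
  subshift X /\
  forall Z : set (full_shift A),
    Z `<=` X -> Z !=set0 -> closed Z -> @shift A @` Z = Z -> Z = X.

Definition occurs_at (A : finType) (x : full_shift A) (u : seq A) (i : int) :
    Prop :=
  u = mkseq (fun k : nat => x (i + k%:Z)) (size u).

Definition language (A : finType) (x : full_shift A) : set (seq A) :=
  [set u | exists i : int, occurs_at x u i].

Definition nb_occurrences (A : finType) (u v : seq A) : nat :=
  count (fun i => prefix u (drop i v)) (iota 0 (size v).+1).

Definition return_word (A : finType) (x : full_shift A) (u w : seq A) : Prop :=
  [/\ language x (w ++ u), prefix u (w ++ u) & nb_occurrences u (w ++ u) = 2%N].

(* Bounded gaps in the two-sided sense: every occurrence has both a next and a
   previous one, at distance at most M (so a word that occurs only finitely
   often is excluded rather than vacuously accepted). *)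
Definition uniformly_recurrent (A : finType) (x : full_shift A) : Prop :=
  forall u, language x u ->
  exists M : nat, forall i : int, occurs_at x u i ->
    (exists2 j : int, occurs_at x u j & i < j <= i + M%:Z) /\
    (exists2 j : int, occurs_at x u j & i - M%:Z <= j < i).

Definition LR_with (A : finType) (x : full_shift A) (K : nat) : Prop :=
  uniformly_recurrent x /\
  forall u w : seq A, u != [::] -> language x u -> return_word x u w ->
    (size w <= K * size u)%N.

Definition LR_subshift (A : finType) (X : set (full_shift A)) : Prop :=
  minimal_subshift X /\
  exists x : full_shift A, X x /\ exists K : nat, LR_with x K.

(* Main.v *)
Require Import Defs.
From mathcomp Require Import all_boot all_order all_algebra all_classical topology.
From mathcomp Require Import zify.

(** Composing the two factor maps gives a factor map [phi] of [X] onto itself,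
    and it suffices that every such [phi] is injective.  By linear recurrence
    all words of length [n] occur in every window of length about [K n], and
    (unless [X] is periodic) two occurrences of a word of length [n] are at
    distance at least about [n / K]; so a window of length proportional to [n]
    contains at most [C] occurrences of any given word of length comparable
    to [n], with [C] independent of [n] and of [phi].
    Suppose [z <> z'] and [phi z = phi z'], and lift them to [a i] and [b i]
    with [phi^i (a i) = z] and [phi^i (b i) = z'].  Take [N > C^2], and [n] much
    larger than the radius of [phi^N].  Cut from [a i] a window of length
    [m = (K + 1) n] that starts with a fixed word [w] of length [n] and in which
    the difference of [z] and [z'] is visible, and the same window from [b i].
    For [i < N] the map [phi^N] does not distinguish [a i] from [b i], so both
    windows begin with words that have the same (trimmed) image as [w].  Hence
    there are at most [C] possible windows on each side, and some [i < j] share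
    both windows.  But [phi^j] identifies [a i] with [b i] and separates [a j]
    from [b j] inside the window. *)

Set Implicit Arguments.
Unset Strict Implicit.
Unset Printing Implicit Defensive.

Import Order.TTheory GRing.Theory Num.Theory.
Local Open Scope ring_scope.
Local Open Scope classical_set_scope.

(** * Agreement of windows and sliding block codes *)

Definition agree (A : Type) (x : int -> A) (p : int) (y : int -> A) (q : int)
    (l h : int) : Prop :=
  forall k, l <= k < h -> x (p + k) = y (q + k).

Lemma agree_trans (A : Type) (x y z : int -> A) p q s l h :
  agree x p y q l h -> agree y q z s l h -> agree x p z s l h.
Proof. by move=> xy yz k hk; rewrite xy // yz. Qed.

Lemma agree_sym (A : Type) (x y : int -> A) p q l h :
  agree x p y q l h -> agree y q x p l h.
Proof. by move=> xy k hk; rewrite xy. Qed.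

Lemma agree_sub (A : Type) (x y : int -> A) p q l h l' h' :
  l <= l' -> h' <= h -> agree x p y q l h -> agree x p y q l' h'.
Proof. by move=> ll hh xy k hk; apply: xy; lia. Qed.

(** Sliding block codes of radius [r]; letting [p] and [q] differ builds in commutation with the
    shift. *)
Definition local_map (A B : Type) (X : set (int -> A)) (r : nat)
    (phi : (int -> A) -> (int -> B)) : Prop :=
  forall x y p q, X x -> X y -> agree x p y q (- r%:Z) (r%:Z + 1) ->
  phi x p = phi y q.

Definition covers_linearly (A : Type) (X : set (int -> A)) (K : nat) : Prop :=
  forall x y n p k, X x -> X y -> (0 < n)%N ->
  exists2 q, k <= q < k + (K * n)%:Z & agree x p y q 0 n%:Z.

Lemma local_map_comp (A B C : Type) (X : set (int -> A)) (Y : set (int -> B))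
    (r s : nat) (f : (int -> A) -> (int -> B)) (g : (int -> B) -> (int -> C)) :
  (forall x, X x -> Y (f x)) -> local_map X r f -> local_map Y s g ->
  local_map X (r + s) (g \o f).
Proof.
move=> fXY lf lg x y p q Xx Xy xy; apply: lg; [exact: fXY|exact: fXY|].
move=> k hk; apply: lf => // j hj; rewrite -!addrA; apply: xy; lia.
Qed.

Lemma iter_stable (T : Type) (X : set T) (f : T -> T) :
  (forall x, X x -> X (f x)) -> forall i x, X x -> X (iter i f x).
Proof. by move=> fX; elim=> //= i IHi x /IHi /fX. Qed.

Lemma local_map_iter (A : Type) (X : set (int -> A)) (r : nat)
    (f : (int -> A) -> (int -> A)) :
  (forall x, X x -> X (f x)) -> local_map X r f ->
  forall i, local_map X (i * r) (iter i f).
Proof.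
move=> fX lf; elim=> [|i IHi].
  move=> x y p q _ _ /(_ 0) xy /=.
  by rewrite -[p]addr0 -[q]addr0; apply: xy; lia.
rewrite mulSn addnC; exact: (local_map_comp (iter_stable fX i) IHi lf).
Qed.

Lemma local_map_agree (A B : Type) (X : set (int -> A)) (r : nat)
    (f : (int -> A) -> (int -> B)) x p y q l h :
  local_map X r f -> X x -> X y -> agree x p y q l h ->
  agree (f x) p (f y) q (l + r%:Z) (h - r%:Z).
Proof.
move=> lf Xx Xy xy k hk; apply: lf => // j hj.
by rewrite -!addrA; apply: xy; lia.
Qed.

(** * Pigeonhole, overlaps and periods *)

Lemma pigeonhole_pairs (C : nat) (f g : nat -> nat) :
  (forall i, (i <= C * C)%N -> (f i < C)%N && (g i < C)%N) ->
  exists i j, [/\ (i < j <= C * C)%N, f i = f j & g i = g j].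
Proof.
move=> fgC; pose c (i : 'I_(C * C).+1) := (f i * C + g i)%N.
have cC i : (c i < C * C)%N.
  by have /andP[? ?] := fgC i (ltn_ord i); rewrite /c; nia.
have /injectivePn [i [j ij cij]] : ~~ injectiveb (fun i => Ordinal (cC i)).
  by apply/negP => /injectiveP /leq_card; rewrite !card_ord ltnn.
have [/andP[fi gi] /andP[fj gj]] :=
  (fgC i (ltn_ord i), fgC j (ltn_ord j)).
have C0 : (0 < C)%N by lia.
have {}cij : c i = c j by case: cij.
have fij : f i = f j.
  have := congr1 (divn^~ C) cij.
  by rewrite /c !divnMDl // !divn_small // !addn0.
have gij : g i = g j by move: cij; rewrite /c fij; lia.
have {}ij : nat_of_ord i <> j by move=> /val_inj ij'; rewrite ij' eqxx in ij.
have [hi hj] := (ltn_ord i, ltn_ord j).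
have [ltij|ltji] := ltnP i j.
  by exists i, j; split=> //; lia.
by exists j, i; split=> //; lia.
Qed.

(** If [L] reached [K * d.+1], every word of length [d.+1] of [X] would start inside the overlap, so
    its first and last letters would coincide and [X] would have period [d]. *)
Lemma self_overlap_short (A : Type) (X : set (int -> A)) (K d L : nat) y q :
  covers_linearly X K -> (0 < d)%N ->
  ~ (forall x k, X x -> x (k + d%:Z) = x k) -> X y ->
  agree y q y (q + d%:Z) 0 L%:Z -> (L < K * d.+1)%N.
Proof.
move=> cX d0 nper Xy yy; rewrite ltnNge; apply/negP => KL; apply: nper => x k Xx.
have [p /andP[qp pq] xy] := cX x y d.+1 k q Xx Xy (ltn0Sn d).
have := xy d%:Z; have := xy 0; rewrite !addr0 => -> //; move=> -> //; last by lia.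
have := yy (p - q); rewrite (_ : q + (p - q) = p); last by lia.
rewrite (_ : q + d%:Z + (p - q) = p + d%:Z); last by lia.
by move=> -> //; lia.
Qed.

Lemma periodic_eq (A : Type) (x y : int -> A) (p q : int) (d : nat) :
  (0 < d)%N -> (forall k, x (k + d%:Z) = x k) -> (forall k, y (k + d%:Z) = y k) ->
  agree x p y q 0 d%:Z -> forall k, x (p + k) = y (q + k).
Proof.
move=> d0 xd yd xy k.
have per (z : int -> A) (zd : forall k, z (k + d%:Z) = z k) (l : int) (j : nat) :
    z (l + (d * j)%N%:Z) = z l.
  elim: j => [|j IHj]; first by rewrite muln0 addr0.
  by rewrite -{}IHj -[RHS]zd; congr (z _); lia.
have [j [i [hj ki]]] : exists j : int, exists i : nat, 0 <= j < d%:Z /\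
    (k = j + (d * i)%N%:Z \/ j = k + (d * i)%N%:Z).
  exists (k %% d%:Z)%Z, `|(k %/ d%:Z)%Z|%N; split; first by lia.
  have := divz_eq k d%:Z; case: (lerP 0 (k %/ d%:Z)%Z) => s; [left|right]; nia.
case: ki => [->|jE].
  by rewrite !addrA !per //; exact: xy.
by have := xy j hj; rewrite jE !addrA !per.
Qed.

Lemma iter_surj (T : Type) (X : set T) (f : T -> T) :
  (forall x, X x -> exists2 y, X y & f y = x) ->
  forall i x, X x -> exists2 y, X y & iter i f y = x.
Proof.
move=> fX; elim=> [|i IHi] x Xx; first by exists x.
have [y Xy <-] := fX x Xx; have [w Xw <-] := IHi y Xy.
by exists w.
Qed.

(** Equal quotients put [4 K p] and [4 K q] less than [n] apart, below the assumed separation. *)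
Lemma separated_code_inj (K n p q : nat) :
  (p < q -> n < 4 * K * (q - p))%N -> (q < p -> n < 4 * K * (p - q))%N ->
  (0 < n)%N -> (4 * K * p %/ n = 4 * K * q %/ n)%N -> p = q.
Proof.
move=> pq qp n0 E.
have := divn_eq (4 * K * p) n; have := divn_eq (4 * K * q) n.
have := ltn_pmod (4 * K * p) n0; have := ltn_pmod (4 * K * q) n0.
rewrite E; set u := (_ %/ n * n)%N; set v1 := (_ %% n)%N; set v2 := (_ %% n)%N.
case: (ltngtP p q) => // [/[dup] h /pq|/[dup] h /qp]; rewrite mulnBr; nia.
Qed.

(** * Injectivity of surjective sliding block codes *)

Theorem local_surjection_inj (A : Type) (X : set (int -> A)) (K r : nat)
    (phi : (int -> A) -> (int -> A)) :
  covers_linearly X K -> (forall x, X x -> X (phi x)) ->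
  (forall x, X x -> exists2 y, X y & phi y = x) -> local_map X r phi ->
  forall x y, X x -> X y -> phi x = phi y -> x = y.
Proof.
move=> cX phiX phiS lphi z z' Xz Xz' zz'; apply: funext => t; apply: contrapT => zt.
have lift w : X w -> exists a : nat -> int -> A,
    forall i, X (a i) /\ iter i phi (a i) = w.
  move=> Xw; suff /choice[u uE] : forall i, exists y, X y /\ iter i phi y = w.
    by exists u.
  by move=> i; have [y] := iter_surj phiS i Xw; exists y.
have [[a aE] [b bE]] := (lift z Xz, lift z' Xz').
have Xa i : X (a i) by case: (aE i).
have Xb i : X (b i) by case: (bE i).
have ab i j : (i < j)%N -> iter j phi (a i) = iter j phi (b i).
  by move=> ij; rewrite -(subnK ij) !iterD /= (aE i).2 (bE i).2 zz'.
(* Apply [phi^j], which trims [j r] on each side: at [t] the images of [a i] and [b i] coincide,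
   while those of [a j] and [b j] are [z t] and [z' t]. *)
have sep i j s s' l h : (i < j)%N ->
    agree (a i) s (a j) s' l h -> agree (b i) s (b j) s' l h ->
    s' + l + (j * r)%:Z <= t < s' + h - (j * r)%:Z -> False.
  move=> ij aa bb hst.
  have lj : local_map X (j * r) (iter j phi) by exact: local_map_iter.
  have hk : l + (j * r)%:Z <= t - s' < h - (j * r)%:Z by lia.
  have := local_map_agree lj (Xa i) (Xa j) aa hk.
  have := local_map_agree lj (Xb i) (Xb j) bb hk.
  rewrite -ab // (aE j).2 (bE j).2 (_ : s' + (t - s') = t); last by lia.
  by move=> -> /esym.
(* In the periodic case one period determines a point, so [K d] positions in [z] already encode all
   of them. *)
have [[d [d0 per]]|aper] := pselect (exists d, (0 < d)%N /\
    forall x k, X x -> x (k + d%:Z) = x k).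
  have code w : (forall i : nat, X (w i)) -> exists p : nat -> nat, forall i,
      (p i < K * d)%N /\ agree (w i) 0 z (p i)%:Z 0 d%:Z.
    move=> Xw; suff /choice[u uE] : forall i, exists p : nat,
        (p < K * d)%N /\ agree (w i) 0 z p%:Z 0 d%:Z by exists u.
    move=> i; have [p hp wp] := cX (w i) z d 0 0 (Xw i) Xz d0.
    by exists `|p|%N; rewrite gez0_abs; [split=> //; lia|lia].
  have [[p pE] [q qE]] := (code a Xa, code b Xb).
  have [i [j [/andP[ij _] pij qij]]] : exists i j,
      [/\ (i < j <= K * d * (K * d))%N, p i = p j & q i = q j].
    by apply: pigeonhole_pairs => i _; rewrite (pE i).1 (qE i).1.
  have glue w (u : nat -> nat) : (forall i, X (w i)) -> u i = u j ->
      (forall i, (u i < K * d)%N /\ agree (w i) 0 z (u i)%:Z 0 d%:Z) ->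
      agree (w i) t (w j) t (- (j * r)%:Z) ((j * r)%:Z + 1).
    move=> Xw uij uE k _.
    have ww : agree (w i) 0 (w j) 0 0 d%:Z.
      by apply: agree_trans (uE i).2 _; rewrite uij; exact: agree_sym (uE j).2.
    have perX l := fun k => per _ k (Xw l).
    by have := periodic_eq d0 (perX i) (perX j) ww (t + k); rewrite !add0r.
  apply: (sep i j t t _ _ ij (glue a p Xa pij pE) (glue b q Xb qij qE)); lia.
(* Occurrences in [0, K m) at pairwise distance > n / (4 K) are told apart by
   p |-> 4 K p %/ n, which takes C = 4 K (K m / n) values. *)
set C := (4 * K * (K * K.+1))%N; set N := (C * C).+1.
set R := (N * r)%N; set n := (4 * R + 2)%N; set m := (K.+1 * n)%N.
have [n0 m0] : (0 < n)%N /\ (0 < m)%N by rewrite /m /n; lia.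
(* The window [[s i, s i + m)] starts at least [i r] before [t]; since [m = K n + n] and [n > 2 R],
   for [i <= N] it also extends more than [i r] beyond [t]. *)
have /choice[s sE] : forall i : nat, exists p : int,
    t - (i * r)%:Z - (K * n)%:Z < p <= t - (i * r)%:Z /\
    agree (a i) p z 0 0 n%:Z.
  move=> i.
  have [p hp zp] :=
    cX z (a i) n 0 (t - (i * r)%:Z - (K * n)%:Z + 1) Xz (Xa i) n0.
  by exists p; split; [lia|exact: agree_sym].
have code w : (forall i : nat, X (w i)) -> exists p : nat -> nat, forall i,
    (p i < K * m)%N /\ agree (w i) (s i) z (p i)%:Z 0 m%:Z.
  move=> Xw; suff /choice[u uE] : forall i, exists p : nat,
      (p < K * m)%N /\ agree (w i) (s i) z p%:Z 0 m%:Z by exists u.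
  move=> i; have [p hp wp] := cX (w i) z m (s i) 0 (Xw i) Xz m0.
  by exists `|p|%N; rewrite gez0_abs; [split=> //; lia|lia].
have [[p pE] [q qE]] := (code a Xa, code b Xb).
have lN : local_map X R (iter N phi) by exact: local_map_iter.
pose y := iter N phi z; have Xy : X y by exact: iter_stable.
(* [H u]: the trimmed image of the reference word [z[0, n)] under [phi^N] reappears in [y] at offset
   [u]. *)
pose H (u : nat) := agree y u%:Z y 0 R%:Z (n%:Z - R%:Z).
have Hpq i : (i < N)%N -> H (p i) /\ H (q i).
  move=> iN; have Ha : agree (iter N phi (a i)) (s i) y 0 R%:Z (n%:Z - R%:Z).
    by have := local_map_agree lN (Xa i) Xz (sE i).2; rewrite add0r.
  have mn : n%:Z - R%:Z <= m%:Z - R%:Z by rewrite /m mulSn; lia.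
  split; apply: agree_trans Ha; apply: agree_sym.
    apply: agree_sub mn (local_map_agree lN (Xa i) Xz (pE i).2).
    by rewrite add0r.
  (* The window of [b i] need not begin with [z[0, n)], but [phi^N] sends [a i] and [b i] to the
     same point. *)
  rewrite ab //; apply: agree_sub mn (local_map_agree lN (Xb i) Xz (qE i).2).
  by rewrite add0r.
have Hsep u v : H u -> H v -> (u < v)%N -> (n < 4 * K * (v - u))%N.
  move=> Hu Hv uv; have d0 : (0 < v - u)%N by lia.
  (* The trimmed word has length [n - 2 R = 2 R + 2 > n / 2]; combine with
     [(v - u).+1 <= 2 (v - u)]. *)
  suff : (2 * R + 2 < K * (v - u).+1)%N by rewrite /n; nia.
  apply: (@self_overlap_short _ X _ _ _ y (u%:Z + R%:Z) cX d0 _ Xy).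
    by move=> per; apply: aper; exists (v - u)%N.
  move=> k hk; have hRk : R%:Z <= R%:Z + k < n%:Z - R%:Z by rewrite /n; lia.
  have := Hu _ hRk; rewrite addrA => ->; rewrite -Hv //.
  by congr (y _); lia.
have [i [j [/andP[ij jN] pij qij]]] : exists i j, [/\ (i < j <= C * C)%N,
    (4 * K * p i %/ n = 4 * K * p j %/ n)%N &
    (4 * K * q i %/ n = 4 * K * q j %/ n)%N].
  apply: pigeonhole_pairs => i _; rewrite !ltn_divLR //.
  have := (pE i).1; have := (qE i).1; rewrite /m /C.
  have ? : (0 < K)%N by have [? ? _] := cX z z 1%N 0 0 Xz Xz isT; lia.
  rewrite -(mulnA (4 * K)%N) -(mulnA K).
  by rewrite !ltn_pmul2l ?muln_gt0 // => -> ->.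
have iN : (i < N)%N := leq_trans ij (leqW jN).
have [[Hpi Hqi] [Hpj Hqj]] := (Hpq i iN, Hpq j jN).
have {}pij : p i = p j by apply: (separated_code_inj _ _ n0 pij); exact: Hsep.
have {}qij : q i = q j by apply: (separated_code_inj _ _ n0 qij); exact: Hsep.
have aa : agree (a i) (s i) (a j) (s j) 0 m%:Z.
  by apply: agree_trans (pE i).2 _; rewrite pij; exact: agree_sym (pE j).2.
have bb : agree (b i) (s i) (b j) (s j) 0 m%:Z.
  by apply: agree_trans (qE i).2 _; rewrite qij; exact: agree_sym (qE j).2.
apply: (sep i j _ _ _ _ ij aa bb); have := (sE j).1.
have : (j * r <= R)%N by rewrite leq_mul2r ltnW ?orbT.
rewrite /m /n mulSn; lia.
Qed.

(** * Topology of the full shift; factor maps are sliding block codes *)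

Definition cylinder (A : finType) (x : full_shift A) (r : nat) :
    set (full_shift A) :=
  [set y | agree y 0 x 0 (- r%:Z) (r%:Z + 1)].

Lemma coord_nbhs (A : finType) (x : full_shift A) (i : int) :
  nbhs x [set y : full_shift A | y i = x i].
Proof.
exact: (@proj_continuous int (fun=> discrete_topology A) i x _
  (@discrete_set1 (discrete_topology A) (x i))).
Qed.

Lemma cylinder_nbhs (A : finType) (x : full_shift A) r : nbhs x (cylinder x r).
Proof.
elim: r => [|r IHr].
  apply: filterS (coord_nbhs x 0) => y /= yx k hk.
  by rewrite !add0r (_ : k = 0) //; lia.
apply: filterS3 IHr (coord_nbhs x (r.+1)%:Z) (coord_nbhs x (- (r.+1)%:Z)).
move=> y yx /= yr yl k hk.
have [->|kr] := eqVneq k (r.+1)%:Z; first by rewrite !add0r.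
have [->|kl] := eqVneq k (- (r.+1)%:Z); first by rewrite !add0r.
by apply: yx; lia.
Qed.

(** The filter generated by the cylinders converges to [x] in each coordinate, hence in the product
    topology. *)
Lemma nbhs_cylinder (A : finType) (x : full_shift A) (U : set (full_shift A)) :
  nbhs x U -> exists r, cylinder x r `<=` U.
Proof.
pose F := filter_from [set: nat] (cylinder x).
have FF : Filter F.
  apply: filter_from_filter; first by exists 0%N.
  move=> i j _ _; exists (maxn i j) => // y yx; split=> k hk; apply: yx; lia.
have Fx : F --> x.
  apply/(@cvg_sup _ _ _ F x FF) => i.
  move=> V [_ [[B _ <-] Bx BV]].
  exists `|i|%N => // y yx; apply: BV.
  have {}yx : y i = x i by have := yx i; rewrite !add0r => -> //; lia.
  by rewrite /= yx.
by move=> /Fx[r _ rU]; exists r.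
Qed.

Lemma full_shift_compact (A : finType) : compact [set: full_shift A].
Proof.
have := @tychonoff int (fun=> discrete_topology A) (fun=> setT).
rewrite (_ : [set f | _] = setT); last by apply/seteqP.
apply=> i; exact/finite_compact/finite_finset.
Qed.

(** Compactness of [X], in near-covering form, turns the radii given by continuity at each point
    into a single one. *)
Lemma continuous_radius (A B : finType) (X : set (full_shift A))
    (f : full_shift A -> full_shift B) :
  closed X -> {within X, continuous f} ->
  exists r : nat, forall x y, X x -> X y -> cylinder x r y -> f x 0 = f y 0.
Proof.
move=> cX /subspace_continuousP cf.
have compX : compact X by apply: subclosed_compact cX (@full_shift_compact A) _.
move/compact_near_coveringP: compX.
move=> /(_ nat \oo (fun r x => X x -> forall y, X y -> cylinder x r y -> f x 0 = f y 0)).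
case.
  move=> x Xx; have : within X (nbhs x) (f @^-1` [set z | z 0 = f x 0]).
    by apply: cf => //; exact: coord_nbhs.
  move=> /nbhs_cylinder[r rf].
  exists (cylinder x r, [set k | (r <= k)%N]).
    by split; [exact: cylinder_nbhs|exists r].
  (* Both [x'] and [y] lie in the cylinder around the centre [x], so both values are compared with
     [f x 0]. *)
  move=> [x' k] [/= xx' rk] Xx1 y Xy x'y.
  rewrite (rf _ xx' Xx1) (rf y _ Xy) // => l hl.
  by rewrite -xx' // x'y //; lia.
move=> r _ rX; exists r => x y Xx Xy xy; exact: (rX r (leqnn r) x Xx Xx y Xy xy).
Qed.

Definition translate (A : Type) (p : int) (x : int -> A) : int -> A :=
  fun n => x (n + p).

Lemma translate_stable (A : finType) (X : set (full_shift A)) p x :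
  @shift A @` X = X -> X x -> X (translate p x).
Proof.
move=> TX Xx.
have Xshift y : X y -> X (shift y) by move=> Xy; rewrite -TX; exists y.
have Xback y : X y -> X (translate (-1) y).
  rewrite -{1}TX => -[w Xw <-]; rewrite (_ : translate _ _ = w) //.
  by apply: funext => n; rewrite /translate /shift addrNK.
have nat_stable (s : int) (j : nat) : (forall y, X y -> X (translate s y)) ->
    X (translate (s * j%:Z) x).
  move=> Xs; elim: j => [|j IHj].
    by rewrite mulr0 (_ : translate _ _ = x) //; apply: funext => n;
       rewrite /translate addr0.
  rewrite (_ : translate _ _ = translate s (translate (s * j%:Z) x)).
    exact: Xs.
  by apply: funext => n; rewrite /translate; congr (x _); lia.
case: (lerP 0 p) => hp.
  have := @nat_stable 1 `|p|%N Xshift; rewrite mul1r gez0_abs //.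
have := @nat_stable (-1) `|p|%N Xback.
by rewrite mulN1r ltz0_abs // opprK.
Qed.

Lemma factor_map_translate (A B : finType) (X : set (full_shift A))
    (Y : set (full_shift B)) f p x :
  @shift A @` X = X -> factor_map X (@shift A) Y (@shift B) f -> X x ->
  f (translate p x) = translate p (f x).
Proof.
move=> TX [_ _ fT] Xx.
have nat_case (j : nat) y : X y -> f (translate j%:Z y) = translate j%:Z (f y).
  elim: j y => [|j IHj] y Xy.
    rewrite (_ : translate _ y = y); first by apply: funext => n; rewrite /translate addr0.
    by apply: funext => n; rewrite /translate addr0.
  rewrite (_ : translate _ y = shift (translate j%:Z y)); last first.
    by apply: funext => n; rewrite /translate /shift; congr (y _); lia.
  rewrite fT; last exact: translate_stable.
  rewrite IHj //; apply: funext => n; rewrite /translate /shift.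
  by congr (f y _); lia.
case: (lerP 0 p) => hp; first by rewrite -(gez0_abs hp) nat_case.
have tK (C : Type) (y : int -> C) (k : int) : translate k (translate (- k) y) = y.
  by apply: funext => n; rewrite /translate addrK.
have [j pE] : exists j : nat, p = - j%:Z by exists `|p|%N; lia.
have := nat_case j (translate p x) (translate_stable p TX Xx).
rewrite pE tK => ->; apply: funext => n; rewrite /translate subrK //.
Qed.

(** The Curtis-Hedlund-Lyndon argument: a radius for coordinate [0] is carried to all coordinates by
    translation. *)
Lemma factor_map_local (A B : finType) (X : set (full_shift A))
    (Y : set (full_shift B)) f :
  subshift X -> factor_map X (@shift A) Y (@shift B) f ->
  exists r, local_map X r f.
Proof.
move=> [cX TX] fXY; have [r rf] := continuous_radius cX (let: And3 c _ _ := fXY in c).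
exists r => x y p q Xx Xy xy.
have := rf _ _ (translate_stable p TX Xx) (translate_stable q TX Xy).
rewrite !(factor_map_translate _ TX fXY) // /translate !add0r; apply=> k hk.
by rewrite add0r addrC -xy // addrC.
Qed.

(** * Return words, minimality and linear covering *)

Definition subword (A : Type) (x : int -> A) (p : int) (n : nat) : seq A :=
  mkseq (fun k : nat => x (p + k%:Z)) n.

Lemma occurs_subword (A : finType) (x : full_shift A) p n q :
  occurs_at x (subword x p n) q <-> agree x p x q 0 n%:Z.
Proof.
rewrite /occurs_at size_mkseq; split=> [E k hk|xx].
  have := congr1 (fun s => nth (x 0) s `|k|%N) E.
  by rewrite !nth_mkseq ?gez0_abs //; lia.
apply: (@eq_from_nth _ (x 0)); rewrite !size_mkseq // => i hi.
by rewrite !nth_mkseq //; apply: xx; lia.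
Qed.

Lemma size_subword (A : Type) (x : int -> A) p n : size (subword x p n) = n.
Proof. exact: size_mkseq. Qed.

Lemma subword_cat (A : Type) (x : int -> A) p m n :
  subword x p (m + n) = subword x p m ++ subword x (p + m%:Z) n.
Proof.
rewrite /subword /mkseq iotaD map_cat add0n; congr (_ ++ _).
rewrite -[X in iota X n]addn0 iotaDl -map_comp.
by apply: eq_map => k /=; congr (x _); lia.
Qed.

(** The disjunct [n = 0] accounts for [i > m], where [drop] leaves the empty word. *)
Lemma prefix_drop_subword (A : finType) (x : full_shift A) p q n m i :
  prefix (subword x p n) (drop i (subword x q m)) <->
  ((i + n <= m)%N \/ n = 0%N) /\ agree x p x (q + i%:Z) 0 n%:Z.
Proof.
have [le_im|lt_mi] := leqP i m; last first.
  rewrite drop_oversize ?size_subword; last exact: ltnW.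
  split=> [/size_prefix|[[imn|->] _]]; last by [].
    by rewrite size_subword leqn0 => /eqP ->; split; [right|move=> k; lia].
  by exfalso; lia.
have -> : drop i (subword x q m) = subword x (q + i%:Z) (m - i).
  rewrite -{1}(subnKC le_im) subword_cat drop_size_cat //; exact: size_subword.
split=> [pre|[nm xx]].
  have nm : (n <= m - i)%N by have := size_prefix pre; rewrite !size_subword.
  split; first by left; lia.
  apply/occurs_subword; move: pre; rewrite -(subnKC nm) subword_cat.
  rewrite prefixE take_size_cat ?size_subword // => /eqP E.
  by rewrite /occurs_at -{1}E size_subword.
have nm' : (n <= m - i)%N by case: nm; lia.
rewrite -(subnKC nm') subword_cat; move/occurs_subword: xx.
by rewrite /occurs_at size_subword -/(subword _ _ _) => <-; exact: prefix_prefix.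
Qed.

(** Induction on [b - a]: cut at an intermediate occurrence and keep the half that straddles [k]. *)
Lemma consecutive_occurrences (P : int -> Prop) (a b k : int) :
  P a -> P b -> a < k <= b ->
  exists a' b', [/\ P a', P b', a' < k <= b' & forall c, a' < c < b' -> ~ P c].
Proof.
have [n] := ubnP `|b - a|%N; elim: n a b => // n IHn a b ban Pa Pb akb.
have [[c [acb Pc]]|none] := pselect (exists c, a < c < b /\ P c); last first.
  by exists a, b; split=> // c acb Pc; apply: none; exists c.
case: (ltrP c k) => ck; first by apply: (IHn c b) => //; lia.
by apply: (IHn a c) => //; lia.
Qed.

Lemma occurrences_unbounded (A : finType) (x : full_shift A) u p (k : int) :
  uniformly_recurrent x -> occurs_at x u p ->
  (exists2 q, occurs_at x u q & q < k) /\ (exists2 q, occurs_at x u q & k <= q).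
Proof.
move=> ur xp; have [M gap] := ur u (ex_intro _ p xp).
have down j : exists2 q, occurs_at x u q & q <= p - j%:Z.
  elim: j => [|j [q xq qj]]; first by exists p => //; lia.
  by have [_ [q' xq' qq']] := gap q xq; exists q' => //; lia.
have up j : exists2 q, occurs_at x u q & p + j%:Z <= q.
  elim: j => [|j [q xq qj]]; first by exists p => //; lia.
  by have [[q' xq' qq'] _] := gap q xq; exists q' => //; lia.
split.
  by have [q xq qk] := down `|k - p|.+1%N; exists q => //; lia.
by have [q xq qk] := up `|k - p|%N; exists q => //; lia.
Qed.

(** Consecutive occurrences [a < k <= b] of the word delimit a return word, so
    [b <= a + K n < k + K n]. *)
Lemma LR_with_gap (A : finType) (x : full_shift A) K n p k :
  LR_with x K -> (0 < n)%N ->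
  exists2 q, k <= q < k + (K * n)%:Z & agree x p x q 0 n%:Z.
Proof.
move=> [ur lr] n0; set u := subword x p n.
have xp : occurs_at x u p by apply/occurs_subword.
have [[a0 xa0 ak0] [b0 xb0 kb0]] := occurrences_unbounded k ur xp.
have akb0 : a0 < k <= b0 by rewrite ak0.
have [a [b [xa xb akb none]]] := consecutive_occurrences xa0 xb0 akb0.
pose d := `|b - a|%N; have bE : b = a + d%:Z by rewrite /d; lia.
have d0 : (0 < d)%N by rewrite /d; lia.
move: xa xb => /occurs_subword xa /occurs_subword xb.
have wu : subword x a d ++ u = subword x a (d + n).
  rewrite subword_cat -bE; congr (_ ++ _); move/occurs_subword: xb.
  by rewrite /occurs_at size_subword.
have occE i : prefix u (drop i (subword x a (d + n))) = (i == 0%N) || (i == d).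
  apply/idP/idP.
    move=> /prefix_drop_subword[id xi].
    have [//|i0] := eqVneq i 0%N; have [//|nid] := eqVneq i d.
    exfalso; apply: (none (a + i%:Z)); last exact/occurs_subword.
    by clear -id i0 nid n0 bE; lia.
  move=> /orP[]/eqP->; apply/prefix_drop_subword; rewrite ?addr0 -?bE.
    by split=> //; left; lia.
  by split=> //; left; lia.
exists b; first (suff : (d <= K * n)%N by lia); last exact: xb.
have := lr u (subword x a d); rewrite !size_subword; apply.
- by rewrite -size_eq0 size_subword; lia.
- by exists p.
- split.
  + by exists a; rewrite wu; apply/occurs_subword.
  + by rewrite wu -[subword x a _]drop0 occE.
  rewrite /nb_occurrences wu size_subword.
  rewrite (eq_count (a2 := predU (pred1 0%N) (pred1 d))) //.
  have := count_predUI (pred1 0%N) (pred1 d) (iota 0 (d + n).+1).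
  rewrite [count (predI _ _) _](@eq_count _ _ pred0); last first.
    by move=> i /=; case: eqVneq => [->|//]; apply/negbTE; rewrite eq_sym -lt0n.
  rewrite count_pred0 addn0 => ->; rewrite !count_uniq_mem ?iota_uniq //.
  by rewrite !mem_iota !leq0n !add0n !ltnS leq_addr.
Qed.

Lemma minimal_orbit_dense (A : finType) (X : set (full_shift A)) x y (r : nat) :
  minimal_subshift X -> X x -> X y ->
  exists p, agree y 0 x p (- r%:Z) (r%:Z + 1).
Proof.
move=> [[cX TX] minX] Xx Xy.
(* The orbit closure of [x], expressed through central windows. *)
pose Z : set (full_shift A) :=
  [set y | forall r : nat, exists p, agree y 0 x p (- r%:Z) (r%:Z + 1)].
suff ZX : Z = X by move: Xy; rewrite -ZX => /(_ r).
have Zx : Z x by move=> s; exists 0.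
(* One extra unit of radius absorbs the translation by [e]. *)
have Zstep w (e : int) : `|e|%N = 1%N -> Z w -> Z (translate e w).
  move=> e1 Zw s; have [p wp] := Zw s.+1; exists (p + e) => k hk.
  rewrite /translate (_ : 0 + k + e = 0 + (k + e)); last by lia.
  by rewrite wp; [congr (x _); lia|lia].
apply: minX; [|by exists x| |].
- move=> w Zw; apply: cX => U /nbhs_cylinder[s sU]; have [p wp] := Zw s.
  exists (translate p x); split; first exact: translate_stable.
  apply: sU => k hk; rewrite wp // /translate.
  by congr (x _); lia.
- move=> w clw s; have [w' [Zw' ww']] := clw _ (cylinder_nbhs w s).
  have [p w'p] := Zw' s; exists p => k hk; rewrite -ww' //; exact: w'p.
- apply/seteqP; split=> [_ [w Zw <-]|w Zw]; first exact: (Zstep w 1).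
  exists (translate (-1) w); first exact: Zstep.
  by apply: funext => k; rewrite /shift /translate addrK.
Qed.

(** By density of its orbit, the LR point [x] contains both the word of [y] and the window of [w];
    the gap bound is applied in [x]. The second radius leaves room for a word starting anywhere in
    the window. *)
Lemma LR_subshift_covers (A : finType) (X : set (full_shift A)) :
  LR_subshift X -> exists K, covers_linearly X K.
Proof.
move=> [minX [x [Xx [K lrx]]]]; exists K => y w n p k Xy Xw n0.
have [s ys] := minimal_orbit_dense (`|p| + n) minX Xx Xy.
have [s' ws] := minimal_orbit_dense (`|k| + K * n + n) minX Xx Xw.
have [q hq xq] := LR_with_gap (s + p) (s' + k) lrx n0.
exists (q - s'); first by lia.
move=> j hj; have := ys (p + j); rewrite add0r => ->; last by lia.
have := ws (q - s' + j); rewrite add0r => ->; last by lia.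
have := xq j hj; rewrite -addrA => ->.
by congr (x _); lia.
Qed.

Theorem corollary17 (A B : finType)
    (X : set (full_shift A)) (Y : set (full_shift B))
    (hX : LR_subshift X) (hY : LR_subshift Y)
    (hXY : weakly_isomorphic X (@shift A) Y (@shift B)) :
  isomorphic X (@shift A) Y (@shift B).
Proof.
have [[g gXY] [f fYX]] := hXY.
have [[[subX _] _] [[subY _] _]] := (hX, hY).
have [K coverX] := LR_subshift_covers hX.
have [r lg] := factor_map_local subX gXY.
have [s lf] := factor_map_local subY fYX.
(* Only injectivity of [g] remains, and it follows from that of [f \o g], a local map of [X] onto
   itself. *)
exists g; split=> //; case: gXY fYX => _ gX _ [_ fY _].
have Yg x : X x -> Y (g x) by move=> Xx; rewrite -gX; exists x.
have Xf y : Y y -> X (f y) by move=> Yy; rewrite -fY; exists y.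
have lfg : local_map X (r + s) (f \o g) := local_map_comp Yg lg lf.
move=> x y /set_mem Xx /set_mem Xy gxy.
apply: (local_surjection_inj coverX _ _ lfg Xx Xy); last by rewrite /= gxy.
  by move=> w /Yg/Xf.
move=> w; rewrite -{1}fY => -[v + <-]; rewrite -{1}gX => -[u Xu <-].
by exists u.
Qed.
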